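(* Let $(X,\perp)$ be an orthogonality space of rank $2$ fulfilling (L1). Then $(X,\perp)=\mathbf{2}(A,B,\varphi)$ for some disjoint subsets $A,B\subseteq X$ and a bijection $\varphi\colon A\to B$. Moreover, any orthogonality space $(X,\perp)$ of the form $\mathbf{2}(A,B,\varphi)$ (with $A,B$ disjoint sets and $\varphi\colon A\to B$ a bijection) has rank $2$ and fulfills (L1).
   Context: An orthogonality space is a non-empty set $X$ equipped with a symmetric, irreflexive binary relation $\perp$. The rank of $(X,\perp)$ is the supremum of the cardinalities of sets of mutually orthogonal elements of $X$. For $A\subseteq X$, $A^{\perp}=\{x\in X: x\perp a \text{ for all } a\in A\}$. $(X,\perp)$ fulfills (L1) if, for any two distinct elements $e,f\in X$ with $e\not\perp f$, there exists $g\in X$ with $g\perp e$ and $\{e,f\}^{\perp}=\{e,g\}^{\perp}$. For disjoint sets $A,B$ (non-empty, since orthogonality spaces are non-empty) and a bijection $\varphi\colon A\to B$, $\mathbf{2}(A,B,\varphi)$ denotes the orthogonality space with underlying set $A\cup B$ and orthogonality relation $\{(a,\varphi(a)): a\in A\}\cup\{(\varphi(a),a): a\in A\}$. *)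

(* Defs.v *)
From mathcomp Require Import all_boot.
From mathcomp Require Import boolp classical_sets functions cardinality.

Set Implicit Arguments.
Unset Strict Implicit.
Unset Printing Implicit Defensive.

Local Open Scope classical_set_scope.
Local Open Scope card_scope.

(* The underlying set is a subset of an ambient type and the relation is a set
   of pairs of its elements, so that two orthogonality spaces over T are equal
   exactly when their underlying sets and their relations coincide. *)
Record orthospace (T : Type) := Orthospace {
  carrier : set T;
  perp : T -> T -> Prop;
  carrier_neq0 : carrier !=set0;
  perp_carrier : forall x y, perp x y -> carrier x /\ carrier y;
  perp_sym : forall x y, perp x y -> perp y x;
  perp_irrefl : forall x, ~ perp x x
}.

Definition mutually_orthogonal (T : Type) (X : orthospace T) (D : set T) :=
  D `<=` carrier X /\ forall x y, D x -> D y -> x <> y -> perp X x y.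

Definition orthocomplement (T : Type) (X : orthospace T) (A : set T) : set T :=
  [set x | carrier X x /\ forall a, A a -> perp X x a].

Definition rank_bound (T : Type) (X : orthospace T) (V : Type) (L : set V) :=
  forall D : set T, mutually_orthogonal X D -> D #<= L.

(* Cardinal numbers are represented by sets over arbitrary types: the rank of X
   is the cardinality of K when the latter is the least cardinal bounding the
   cardinalities of all mutually orthogonal sets. *)
Definition has_rank (T : Type) (X : orthospace T) (V : Type) (K : set V) :=
  rank_bound X K /\
  forall (W : Type) (L : set W), rank_bound X L -> K #<= L.

Definition condL1 (T : Type) (X : orthospace T) :=
  forall e f, carrier X e -> carrier X f -> e <> f -> ~ perp X e f ->
  exists g, [/\ carrier X g, perp X g e &
    orthocomplement X [set e; f] = orthocomplement X [set e; g]].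

(* A bijection from A to B is a function on the ambient type that restricts to
   one; its values outside A are irrelevant. *)
Section TwoSpace.
Variables (T : Type) (A B : set T) (phi : T -> T).
Hypotheses (A0 : A !=set0) (AB0 : A `&` B = set0) (phiAB : set_bij A B phi).

Definition two_perp (x y : T) : Prop :=
  (A x /\ y = phi x) \/ (A y /\ x = phi y).

Lemma two_carrier_neq0 : (A `|` B) !=set0.
Proof. by have [a Aa] := A0; exists a; left. Qed.

Lemma two_perp_carrier x y :
  two_perp x y -> (A `|` B) x /\ (A `|` B) y.
Proof.
have [phiB _ _] := phiAB.
by case=> -[Aa ->]; split; [left|right|right|left] => //; apply: phiB.
Qed.

Lemma two_perp_sym x y : two_perp x y -> two_perp y x.
Proof. by case=> ?; [right|left]. Qed.

Lemma two_perp_irrefl x : ~ two_perp x x.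
Proof.
have [phiB _ _] := phiAB.
have K : A x -> x = phi x -> False.
  move=> Ax xE; have : (A `&` B) x by split=> //; rewrite xE; apply: phiB.
  by rewrite AB0.
by case=> -[]; exact: K.
Qed.

Definition two_space : orthospace T :=
  Orthospace two_carrier_neq0 two_perp_carrier two_perp_sym two_perp_irrefl.

End TwoSpace.

(* Main.v *)
(* Both conditions together amount to orthogonality being a perfect matching:
   every point has exactly one orthogonal partner. Indeed, if x had two partners
   y <> z in a space of rank 2, then y and z would not be orthogonal, so (L1)
   would yield g orthogonal to y with x in {y, z}^perp = {y, g}^perp, making
   x, y, g mutually orthogonal. Choosing one point from each pair of partners
   gives A, and B is the set of the remaining points. *)
Require Import Defs.
From mathcomp Require Import all_boot.
From mathcomp Require Import boolp classical_sets functions cardinality.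

Set Implicit Arguments.
Unset Strict Implicit.
Unset Printing Implicit Defensive.

Local Open Scope classical_set_scope.
Local Open Scope card_scope.

Definition unique_partner (T : Type) (X : orthospace T) :=
  forall x, carrier X x -> exists2 y, perp X x y & forall z, perp X x z -> z = y.

Lemma card_le_image_sub (T U : Type) (f : U -> T) (L : set U) (D : set T) :
  D `<=` f @` L -> D #<= L.
Proof. by move=> /subset_card_le DL; apply: card_le_trans DL (card_image_le f L). Qed.

Lemma card_le_inj_image (T U : Type) (f : U -> T) (L : set U) (D : set T) :
  {in L &, injective f} -> f @` L `<=` D -> L #<= D.
Proof.
move=> /inj_card_eq fL /subset_card_le; apply: card_le_trans.
by move: fL; rewrite card_eq_le => /andP[].
Qed.

Lemma card_le_I2_pair (T : Type) (x y : T) : x <> y -> `I_2 #<= [set x; y].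
Proof.
move=> xy; apply: (@card_le_inj_image _ _ (fun i => if i is 0 then x else y)).
  move=> i j; rewrite !inE /=.
  by case: i => [|[|//]]; case: j => [|[|//]] //= _ _ /esym.
by move=> z [[|i] _ <-]; [left|right].
Qed.

(** The remaining fields are proofs of propositions, so proof irrelevance identifies them. *)
Lemma orthospace_eq (T : Type) (X Y : orthospace T) :
  carrier X = carrier Y -> perp X = perp Y -> X = Y.
Proof.
case: X Y => [C P a b c d] [C' P' a' b' c' d'] /= CE PE.
by subst; congr Orthospace; apply: Prop_irrelevance.
Qed.

Section Orthospace.
Variables (T : Type) (X : orthospace T).

Lemma perp_neq x y : perp X x y -> x <> y.
Proof. by move=> xy xE; move: xy; rewrite xE; apply: perp_irrefl. Qed.

Lemma mutually_orthogonal2 x y :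
  perp X x y -> mutually_orthogonal X [set x; y].
Proof.
move=> xy; have [Cx Cy] := perp_carrier xy.
split=> [z [->|->] //|u v [->|->] [->|->]] // _.
exact: perp_sym.
Qed.

(** Three pairwise orthogonal points are distinct by irreflexivity and would form a mutually
    orthogonal set of cardinality 3. *)
Lemma rank_bound2_no_triple x y z : rank_bound X `I_2 ->
  perp X x y -> perp X x z -> ~ perp X y z.
Proof.
move=> rk xy xz yz.
have [Cx Cy] := perp_carrier xy; have [_ Cz] := perp_carrier xz.
have D : mutually_orthogonal X [set u | [\/ u = x, u = y | u = z]].
  split=> [u []-> //|u v [->|->|->] [->|->|->]] // _; exact: perp_sym.
suff : `I_3 #<= `I_2 by rewrite card_le_II.
apply: card_le_trans (rk _ D).
(* The default value [z] is the image of 2, so that 0, 1, 2 enumerate [x], [y], [z]. *)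
apply: (@card_le_inj_image _ _ (nth z [:: x; y])).
  move=> i j; rewrite !inE /=.
  case: i => [|[|[|//]]]; case: j => [|[|[|//]]] //= _ _ E; exfalso.
  - exact: (perp_neq xy).
  - exact: (perp_neq xz).
  - by apply: (perp_neq xy).
  - exact: (perp_neq yz).
  - by apply: (perp_neq xz).
  - by apply: (perp_neq yz).
by move=> u [[|[|[|//]]] _ <-]; [apply: Or31|apply: Or32|apply: Or33].
Qed.

(** Without orthogonal pairs, mutually orthogonal sets have at most one element, so 1 would be a
    bound smaller than the rank. *)
Lemma has_rank2_exists_perp : has_rank X `I_2 -> exists x y, perp X x y.
Proof.
move=> [_ rk]; apply: contrapT => noperp.
suff /rk : rank_bound X `I_1 by rewrite card_le_II.
move=> D [DC Dperp].
have [->|/eqP/set0P[d Dd]] := pselect (D = set0).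
  exact: card_ge0.
apply: (@card_le_image_sub _ _ (fun=> d)) => e De; exists 0 => //.
apply: contrapT => de; apply: noperp; exists d, e; exact: Dperp.
Qed.

Lemma rank2_L1_unique_partner :
  has_rank X `I_2 -> condL1 X -> unique_partner X.
Proof.
move=> rk L1 x Cx.
(* Rank 2 provides only some pair [e], [f]; when [x] is neither equal nor orthogonal to [e], (L1)
   for [x] and [e] supplies a partner of [x]. *)
have [y xy] : exists y, perp X x y.
  have [e [f ef]] := has_rank2_exists_perp rk; have [Ce _] := perp_carrier ef.
  have [->|xe] := pselect (x = e); first by exists f.
  have [xpe|xpe] := pselect (perp X x e); first by exists e.
  by have [g [_ gx _]] := L1 _ _ Cx Ce xe xpe; exists g; exact: perp_sym.
exists y => // z xz; apply: contrapT => zy.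
have [[_ Cy] [_ Cz]] := (perp_carrier xy, perp_carrier xz).
have yz : ~ perp X y z by apply: rank_bound2_no_triple rk.1 xy xz.
have [g [_ gy E]] := L1 _ _ Cy Cz (nesym zy) yz.
have [_ xyg] : orthocomplement X [set y; g] x by rewrite -E; split=> // a [->|->].
apply: (@rank_bound2_no_triple x g y rk.1 _ xy gy).
by apply: xyg; right.
Qed.

Lemma unique_partner_eq : unique_partner X ->
  forall x y z, perp X x y -> perp X x z -> y = z.
Proof.
move=> up x y z xy xz; have [w _ wP] := up x (perp_carrier xy).1.
by rewrite (wP _ xy) (wP _ xz).
Qed.

Lemma unique_partner_rank2 : unique_partner X -> has_rank X `I_2.
Proof.
move=> up; split=> [D [DC Dperp]|W L Lb].
  have [->|/eqP/set0P[d Dd]] := pselect (D = set0); first exact: card_ge0.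
  have [y dy yP] := up d (DC _ Dd).
  (* Any element of [D] other than [d] is orthogonal to [d], hence is its partner [y], which the
     default value makes the image of 1. *)
  apply: (@card_le_image_sub _ _ (nth y [:: d])) => e De.
  have [->|de] := pselect (e = d); first by exists 0.
  by exists 1 => //=; rewrite (yP e) //; apply: Dperp => // /esym.
(* Leastness: every bound must already dominate a single pair of partners. *)
have [x Cx] := carrier_neq0 X; have [y xy _] := up x Cx.
apply: card_le_trans (card_le_I2_pair (perp_neq xy)) _.
exact/Lb/mutually_orthogonal2.
Qed.

(** With [g] the partner of [e], both complements are empty: a point in either would have two
    distinct partners. *)
Lemma unique_partner_L1 : unique_partner X -> condL1 X.
Proof.
move=> up e f Ce Cf ef nef; have [g eg gP] := up e Ce.
exists g; split; [exact: (perp_carrier eg).2|exact: perp_sym|].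
rewrite eqEsubset; split=> x [Cx xP]; exfalso.
  by apply: ef; apply: (unique_partner_eq up (x := x)); apply: xP; [left|right].
by apply: (perp_neq eg); apply: (unique_partner_eq up (x := x)); apply: xP;
  [left|right].
Qed.

Lemma unique_partner_two_space : unique_partner X ->
  exists (A B : set T) (phi : T -> T)
    (A0 : A !=set0) (AB0 : A `&` B = set0) (phiAB : set_bij A B phi),
    [/\ A `<=` carrier X, B `<=` carrier X & X = two_space A0 AB0 phiAB].
Proof.
move=> up.
have [p pP] : {p : T -> T & forall x, carrier X x -> perp X x (p x)}.
  apply: (@choice _ _ (fun x y => carrier X x -> perp X x y)) => x.
  have [/up[y xy _]|nCx] := pselect (carrier X x); first by exists y.
  by exists x.
have [x0 Cx0] := carrier_neq0 X.
(* Choosing from sets rather than from points lets [x] and [p x] share one choice, since both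
   determine the same unordered pair. *)
have [c cP] : {c : set T -> T & forall D, D !=set0 -> D (c D)}.
  apply: (@choice _ _ (fun D y => D !=set0 -> D y)) => D.
  have [[y Dy]|nD] := pselect (D !=set0); first by exists y.
  by exists x0.
have pE x y : perp X x y -> y = p x.
  by move=> xy; exact: (unique_partner_eq up xy (pP _ (perp_carrier xy).1)).
have pC x : carrier X x -> carrier X (p x) by move=> Cx; case: (perp_carrier (pP _ Cx)).
have pK x : carrier X x -> p (p x) = x by move=> Cx; rewrite -(pE _ _ (perp_sym (pP _ Cx))).
have pn x : carrier X x -> x <> p x by move=> Cx; exact: perp_neq (pP _ Cx).
have pairE x : carrier X x -> [set p x; p (p x)] = [set x; p x].
  by move=> Cx; rewrite pK // setUC.
have cpair x : c [set x; p x] = x \/ c [set x; p x] = p x.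
  by apply: (cP [set x; p x]); exists x; left.
pose A := [set x | carrier X x /\ c [set x; p x] = x].
pose B := [set x | carrier X x /\ c [set x; p x] <> x].
have pAB x : A x -> B (p x).
  by move=> [Cx cx]; split; [exact: pC|rewrite pairE // cx; exact: pn].
have pBA x : B x -> A (p x).
  move=> [Cx cx]; split; [exact: pC|rewrite pairE //].
  by case: (cpair x).
have AVB x : carrier X x -> A x \/ B x.
  by move=> Cx; have [?|?] := pselect (c [set x; p x] = x); [left|right].
have A0 : A !=set0.
  by have [Ax|/pBA Ax] := AVB _ Cx0; [exists x0|exists (p x0)].
have AB0 : A `&` B = set0 by rewrite -subset0 => x [[_ cx] [_]].
have phiAB : set_bij A B p.
  split=> [x /pAB //|x y|y By].
    by rewrite !inE => -[Cx _] [Cy _] /(congr1 p); rewrite !pK.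
  by exists (p y); [exact: pBA|apply: pK; case: By].
exists A, B, p, A0, AB0, phiAB; split=> [x []//|x []//|].
apply: orthospace_eq => /=.
  by rewrite eqEsubset; split=> [x /AVB //|x [[]|[]]].
apply/funext => x; apply/funext => y; apply/propext; split=> [xy|].
  have [Cx Cy] := perp_carrier xy.
  have [Ax|Bx] := AVB _ Cx; first by left; split=> //; exact: pE.
  (* For [x] in [B] the pair is read from its other end: [p x] lies in [A] and [p] sends it back to
     [x]. *)
  right; rewrite (pE _ _ xy); split; first exact: pBA.
  by rewrite pK.
by case=> -[[C _] ->]; [|apply: perp_sym]; exact: pP.
Qed.

End Orthospace.

(** A point of [A] has its image under [phi] as partner, a point of [B] its preimage. Disjointness
    excludes partners of the other kind, and injectivity makes the preimage unique. *)
Lemma two_space_unique_partner (T : Type) (A B : set T) (phi : T -> T)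
    (A0 : A !=set0) (AB0 : A `&` B = set0) (phiAB : set_bij A B phi) :
  unique_partner (two_space A0 AB0 phiAB).
Proof.
have [phiB phi_inj phi_surj] := phiAB.
have nAB x : A x -> ~ B x by move=> Ax Bx; rewrite -[False]/(set0 x) -AB0.
move=> x /= [Ax|Bx].
  exists (phi x); first by left.
  by move=> z [[_]//|[Az xE]]; case: (nAB x) => //; rewrite xE; exact: phiB.
have [a Aa aE] := phi_surj _ Bx.
exists a; first by right.
move=> z [[Ax]|[Az xE]]; first by case: (nAB x).
by apply: phi_inj; rewrite ?inE // aE.
Qed.

Theorem proposition23 :
  (forall (T : Type) (X : orthospace T),
     has_rank X `I_2 -> condL1 X ->
     exists (A B : set T) (phi : T -> T)
       (A0 : A !=set0) (AB0 : A `&` B = set0) (phiAB : set_bij A B phi),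
       [/\ A `<=` carrier X, B `<=` carrier X & X = two_space A0 AB0 phiAB])
  /\
  (forall (T : Type) (A B : set T) (phi : T -> T)
     (A0 : A !=set0) (AB0 : A `&` B = set0) (phiAB : set_bij A B phi),
     has_rank (two_space A0 AB0 phiAB) `I_2 /\
     condL1 (two_space A0 AB0 phiAB)).
Proof.
split=> [T X rk L1|T A B phi A0 AB0 phiAB].
  exact/unique_partner_two_space/rank2_L1_unique_partner.
have up := @two_space_unique_partner _ _ _ _ A0 AB0 phiAB.
by split; [exact: unique_partner_rank2|exact: unique_partner_L1].
Qed.
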